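(* Let $\mathbf{P}(s,t,u)=\big(a(s,t,u),b(s,t,u),c(s,t,u),d(s,t,u)\big)$ be a rational parametric surface with no base points, and let $\mathbf{L}(s,t,u)$ be a moving plane following $\mathbf{P}(s,t,u)$. If $\mathbf{X}_0=(x_0,y_0,z_0,w_0)$, with $w_0\neq0$, is an $r$-fold singular point on the surface, then the system $$w_0\,a(s,t,u)-x_0\,d(s,t,u)=0,\quad w_0\,b(s,t,u)-y_0\,d(s,t,u)=0,\quad w_0\,c(s,t,u)-z_0\,d(s,t,u)=0,\quad \mathbf{L}(s,t,u)\cdot\mathbf{X}_0=0$$ has $r$ intersection points (counting multiplicity).
   Context: Rational parametric surface: $\mathbf{P}(s,t)=(a(s,t),b(s,t),c(s,t),d(s,t))$ in homogeneous coordinates of projective 3-space, with $a,b,c,d\in\mathbb{R}[s,t]$, $\gcd(a,b,c,d)=1$, whose image is a surface; $\mathbf{P}(s,t,u)$ denotes its homogeneous form, where $a,b,c,d$ are homogenized with $u$ to homogeneous polynomials of a common degree $n$. Base points are the points $(s,t,u)\in\mathbb{P}^2(\mathbb{C})$ (possibly complex, possibly at infinity) at which $a=b=c=d=0$; ''no base points'' means there are none. Moving plane: $\mathbf{L}(s,t)=(A(s,t),B(s,t),C(s,t),D(s,t))$ with $A,B,C,D\in\mathbb{R}[s,t]$, representing the family of planes $Ax+By+Cz+Dw=0$. It follows $\mathbf{P}$ if $Aa+Bb+Cc+Dd\equiv0$. $\mathbf{L}(s,t,u)$ denotes its homogeneous form ($A,B,C,D$ homogenized with $u$ to a common degree), so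 that $\mathbf{L}(s,t,u)\cdot\mathbf{P}(s,t,u)\equiv0$. For $\mathbf{L}=(A,B,C,D)$, $\mathbf{L}\cdot\mathbf{X}_0=Ax_0+By_0+Cz_0+Dw_0$. Intersection multiplicity of several planar curves: let $C_1,\dots,C_v$ be given in $\mathbb{P}^2(\mathbb{C})$ by homogeneous equations $f_1(s,t,u)=0,\dots,f_v(s,t,u)=0$, and let $p$ be an isolated common point. Let $R_p=\mathcal{O}_{\mathbb{P}^2,p}$, let $\widetilde f_i$ be a local equation of $C_i$ at $p$, and $I_p=\langle\widetilde f_1,\dots,\widetilde f_v\rangle\subset R_p$. The intersection multiplicity at $p$ is $m(p)=e(I_p,R_p)$, the (Hilbert–Samuel) multiplicity, i.e. the number $e$ with $\dim_{\mathbb{C}}(R_p/I_p^{\,l+1})=\frac{e}{2!}l^2+(\text{lower order terms in } l)$ for $l\gg0$. A system $f_1=\dots=f_v=0$ has $N$ intersection points counting multiplicity if its common zero set in $\mathbb{P}^2(\mathbb{C})$ is finite and $\sum_p m(p)=N$ over the common zeros $p$. $r$-fold singular point (surface without base points): $\mathbf{X}_0=(x_0,y_0,z_0,w_0)$ with $w_0\ne0$ is an $r$-fold singular point of $\mathbf{P}$ if the system $w_0a-x_0d=w_0b-y_0d=w_0c-z_0d=0$ has exactly $r$ intersection points in the $(s,t,u)$-plane, counting multiplicity. *)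

(* Defs.v *)
(* The reals are R : realType and the complex numbers are R[i]. *)
From HB Require Import structures.
From mathcomp Require Import all_boot all_order all_algebra.
From mathcomp Require Import fraction reals complex mpoly.

Set Implicit Arguments.
Unset Strict Implicit.
Unset Printing Implicit Defensive.
Import Order.TTheory GRing.Theory Num.Theory.
Local Open Scope ring_scope.
Local Open Scope complex_scope.

(* Points of P^n(C) are given by nonzero row vectors of homogeneous
   coordinates, taken up to [proportional]. *)
Section ProjectiveGeometry.
Variable C : fieldType.

Definition proportional k (p q : 'rV[C]_k) : Prop :=
  exists2 c : C, c != 0 & q = c *: p.

Definition common_zero k (fs : seq {mpoly C[k]}) (p : 'rV[C]_k) : Prop :=
  p != 0 /\ forall f, f \in fs -> f.@[p 0] = 0.

(* Zariski closure in projective space of a set S of points. *)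
Definition zariski_closure k (S : 'rV[C]_k -> Prop) (X : 'rV[C]_k) : Prop :=
  X != 0 /\
  forall d (G : {mpoly C[k]}), G \is d.-homog ->
    (forall Y, S Y -> G.@[Y 0] = 0) -> G.@[X 0] = 0.

Definition irreducible_mpoly k (F : {mpoly C[k]}) : Prop :=
  [/\ F != 0, F \isn't a GRing.unit &
      forall G H, F = G * H -> G \is a GRing.unit \/ H \is a GRing.unit].

Definition is_hypersurface k (S : 'rV[C]_k -> Prop) : Prop :=
  exists d (F : {mpoly C[k]}),
    [/\ F \is d.-homog, irreducible_mpoly F &
        forall X, X != 0 -> (S X <-> F.@[X 0] = 0)].

End ProjectiveGeometry.

(* The local ring of P^2 at p is realized inside the fraction field of
   C[s,t,u], as the fractions f / g of forms of the same degree with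
   g(p) <> 0; its subsets (ideals) are predicates on that field. *)
Section LocalMultiplicity.
Variable C : fieldType.
Notation K := {fraction {mpoly C[3]}}.
Notation "x %:F" := (@tofrac {mpoly C[3]} x).

Definition local_ring (p : 'rV[C]_3) (x : K) : Prop :=
  exists d (f g : {mpoly C[3]}),
    [/\ f \is d.-homog, g \is d.-homog, g.@[p 0] != 0 & x = f%:F / g%:F].

(* A local equation at p of the curve f = 0, for a form f. Two of them differ
   by a unit of the local ring, so they generate the same ideal. *)
Definition local_equation (p : 'rV[C]_3) (f : {mpoly C[3]}) (x : K) : Prop :=
  exists d (g : {mpoly C[3]}),
    [/\ f \is d.-homog, g \is d.-homog, g.@[p 0] != 0 & x = f%:F / g%:F].

Definition ideal_generated (O G : K -> Prop) (x : K) : Prop :=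
  exists k (r g : 'I_k -> K),
    (forall i, O (r i) /\ G (g i)) /\ x = \sum_(i < k) r i * g i.

Definition ideal_power (O I : K -> Prop) (l : nat) : K -> Prop :=
  ideal_generated O
    (fun y => exists g : 'I_l -> K,
       (forall i, I (g i)) /\ y = \prod_(i < l) g i).

Definition local_ideal (p : 'rV[C]_3) (fs : seq {mpoly C[3]}) : K -> Prop :=
  ideal_generated (local_ring p)
    (fun x => exists2 f, f \in fs & local_equation p f x).

(* dim_C (O / J) = N: some N elements of O form a C-basis modulo J. *)
Definition quotient_dim (O J : K -> Prop) (N : nat) : Prop :=
  exists e : 'I_N -> K,
    [/\ forall i, O (e i),
        forall c : 'I_N -> C,
          J (\sum_(i < N) (c i)%:MP%:F * e i) -> forall i, c i = 0 &
        forall x, O x ->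
          exists c : 'I_N -> C, J (x - \sum_(i < N) (c i)%:MP%:F * e i)].

(* e(I, O): dim_C (O / I^(l+1)) = (e / 2!) l^2 + q(l) for l >> 0, deg q <= 1. *)
Definition hilbert_samuel_multiplicity (O I : K -> Prop) (e : nat) : Prop :=
  exists (q : {poly rat}) (l0 : nat),
    (size q <= 2)%N /\
    forall l, (l0 <= l)%N ->
      exists2 N : nat, quotient_dim O (ideal_power O I l.+1) N &
        N%:R = e%:R / 2 * l%:R ^+ 2 + q.[l%:R].

Definition intersection_multiplicity
    (fs : seq {mpoly C[3]}) (p : 'rV[C]_3) (e : nat) : Prop :=
  hilbert_samuel_multiplicity (local_ring p) (local_ideal p fs) e.

(* The system fs = 0 has N intersection points counting multiplicity.
   The finite common zero set is listed, without repetition in P^2, as pt. *)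
Definition intersection_points (fs : seq {mpoly C[3]}) (N : nat) : Prop :=
  exists k (pt : 'I_k -> 'rV[C]_3) (e : 'I_k -> nat),
    [/\ forall i, common_zero fs (pt i),
        forall i j, proportional (pt i) (pt j) -> i = j,
        forall q, common_zero fs q -> exists i, proportional (pt i) q,
        forall i, intersection_multiplicity fs (pt i) (e i) &
        (\sum_(i < k) e i)%N = N].

End LocalMultiplicity.

Section ParametricSurface.
Variable R : realType.

(* Meaningful when p has total degree <= n, i.e. msize p <= n.+1 (the exponent
   n - mdeg m of u is a truncated subtraction). *)
Definition homogenize (n : nat) (p : {mpoly R[2]}) : {mpoly R[3]} :=
  \sum_(m <- msupp p)
    p@_m *: 'X_[[multinom [tuple m 0; m 1; (n - mdeg m)%N]]].

Definition complex_form (n : nat) (p : {mpoly R[2]}) : {mpoly R[i][3]} :=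
  map_mpoly (real_complex R) (homogenize n p).

(* (a, b, c, d) is indexed by 'I_4: P 0 = a, P 1 = b, P 2 = c, P 3 = d, and
   likewise for (A, B, C, D) and (x0, y0, z0, w0). *)
Definition coprime_components (P : 'I_4 -> {mpoly R[2]}) : Prop :=
  forall g, (forall i, exists q, P i = q * g) -> g \is a GRing.unit.

(* The image in P^3(C) of the parameters (s, t) in C^2 where P is defined. *)
Definition parametrized_points
    (P : 'I_4 -> {mpoly R[2]}) (X : 'rV[R[i]]_4) : Prop :=
  exists q : 'rV[R[i]]_2,
    let Y := \row_i (map_mpoly (real_complex R) (P i)).@[q 0] in
    Y != 0 /\ proportional Y X.

Definition on_surface (P : 'I_4 -> {mpoly R[2]}) (X : 'rV[R[i]]_4) : Prop :=
  zariski_closure (parametrized_points P) X.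

(* The image is a surface: its Zariski closure is an irreducible hypersurface,
   the zero set of the implicit equation of the surface. *)
Definition rational_surface (P : 'I_4 -> {mpoly R[2]}) : Prop :=
  coprime_components P /\ is_hypersurface (on_surface P).

Definition no_base_points (n : nat) (P : 'I_4 -> {mpoly R[2]}) : Prop :=
  ~ exists q : 'rV[R[i]]_3,
      q != 0 /\ forall i, (complex_form n (P i)).@[q 0] = 0.

Definition follows (L P : 'I_4 -> {mpoly R[2]}) : Prop :=
  \sum_(i < 4) L i * P i = 0.

Definition moving_plane_at (m : nat) (L : 'I_4 -> {mpoly R[2]})
    (X0 : 'rV[R[i]]_4) : {mpoly R[i][3]} :=
  \sum_(i < 4) X0 0 i *: complex_form m (L i).

Definition point_system (n : nat) (P : 'I_4 -> {mpoly R[2]})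
    (X0 : 'rV[R[i]]_4) : seq {mpoly R[i][3]} :=
  [seq X0 0 3 *: complex_form n (P i) - X0 0 i *: complex_form n (P 3)
     | i : 'I_4 <- [:: 0; 1; 2]].

Definition fold_singular_point (r n : nat) (P : 'I_4 -> {mpoly R[2]})
    (X0 : 'rV[R[i]]_4) : Prop :=
  X0 0 3 != 0 /\ intersection_points (point_system n P X0) r.

End ParametricSurface.

(* Main.v *)
From HB Require Import structures.
Require Import Defs.
From mathcomp Require Import all_boot all_order all_algebra.
From mathcomp Require Import boolp fraction reals complex ssrcomplements mpoly.
Local Open Scope ring_scope.
Local Open Scope complex_scope.

Set Implicit Arguments.
Unset Strict Implicit.
Unset Printing Implicit Defensive.
Import GRing.Theory.

(** The moving plane condition is, after homogenization, [\sum_i L_i P_i = 0].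
    Multiplying it by [w0] and using [w0 P_i = (w0 P_i - x_i d) + x_i d], where
    [d] is the last component of [P], gives

      [d * (L . X0) = - \sum_(i < 3) L_i * (w0 P_i - x_i d)].

    At a common zero [p] of the forms [w0 P_i - x_i d] the form [d] does not
    vanish: otherwise [w0 P_i] would vanish at [p] for every [i], and [p] would
    be a base point.  So [d] is a unit of the local ring at [p], and the
    identity says that [L . X0] vanishes at [p] and lies in the local ideal of
    the other three curves ([local_ideal_rcons]).  Adding this curve to the
    system changes neither the common zeros nor the local ideals at them, hence
    neither their multiplicities ([intersection_points_rcons]).

    What remains is that the affine identity [\sum_i L_i P_i = 0] homogenizes,
    that is, that homogenization turns products into products
    ([homogenizeM]). *)

(** * Ideals given by generators *)

Section IdealGenerated.
Variable C : fieldType.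
Notation K := {fraction {mpoly C[3]}}.
Variables (O G : K -> Prop).

Lemma ideal_generated0 : ideal_generated O G 0.
Proof.
exists 0%N, (fun _ => 0), (fun _ => 0).
by split; [case | rewrite big_ord0].
Qed.

Lemma ideal_generatedD x y :
  ideal_generated O G x -> ideal_generated O G y -> ideal_generated O G (x + y).
Proof.
move=> [k [r [g [rgP ->]]]] [l [r' [g' [rgP' ->]]]].
pose cat (u : 'I_k -> K) (v : 'I_l -> K) (i : 'I_(k + l)) :=
  match split i with inl j => u j | inr j => v j end.
exists (k + l)%N, (cat r r'), (cat g g'); split.
  by move=> i; rewrite /cat; case: (split i).
rewrite big_split_ord /cat; congr (_ + _); apply: eq_bigr => i _.
  by rewrite -[lshift l i]/(unsplit (inl i)) unsplitK.
by rewrite -[rshift k i]/(unsplit (inr i)) unsplitK.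
Qed.

Lemma ideal_generated_sum (I : eqType) (s : seq I) (F : I -> K) :
    {in s, forall i, ideal_generated O G (F i)} ->
  ideal_generated O G (\sum_(i <- s) F i).
Proof.
move=> FP; rewrite big_seq; apply: big_ind => //.
- exact: ideal_generated0.
- exact: ideal_generatedD.
Qed.

Lemma ideal_generated_scale r g : O r -> G g -> ideal_generated O G (r * g).
Proof.
move=> Or Gg; exists 1%N, (fun _ => r), (fun _ => g).
by rewrite big_ord1.
Qed.

End IdealGenerated.

Lemma ideal_generated_subset (C : fieldType)
    (O G G' : {fraction {mpoly C[3]}} -> Prop) :
    (forall x y, O x -> O y -> O (x * y)) ->
    (forall g, G g -> ideal_generated O G' g) ->
  forall x, ideal_generated O G x -> ideal_generated O G' x.
Proof.
move=> OM GG' x [k [r [g [rgP ->]]]].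
apply: ideal_generated_sum => i _; have [Or Gg] := rgP i.
have [l [r' [g' [rgP' ->]]]] := GG' _ Gg.
rewrite mulr_sumr; apply: ideal_generated_sum => j _; rewrite mulrA.
by have [Or' G'g'] := rgP' j; apply: ideal_generated_scale => //; apply: OM.
Qed.

(** * The local ideal of a system of plane curves *)

Section LocalIdeal.
Variable C : fieldType.
Implicit Types (p : 'rV[C]_3) (fs : seq {mpoly C[3]}) (f g h : {mpoly C[3]}).

Lemma local_ring1 p : local_ring p 1.
Proof.
exists 0%N, 1, 1; rewrite rmorph1 divr1 rmorph1 oner_neq0.
by split=> //; apply: dhomog1.
Qed.

Lemma local_ringM p x y : local_ring p x -> local_ring p y -> local_ring p (x * y).
Proof.
move=> [d [f [g [fd gd gp ->]]]] [e [f' [g' [fe ge gp' ->]]]].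
exists (d + e)%N, (f * f'), (g * g'); split; try exact: dhomogM.
  by rewrite rmorphM mulf_neq0.
by rewrite mulf_div !tofracM.
Qed.

Lemma local_ideal_subset p fs gs :
  {subset fs <= gs} -> forall x, local_ideal p fs x -> local_ideal p gs x.
Proof.
move=> fs_gs; apply: ideal_generated_subset; first exact: local_ringM.
move=> x [f f_fs fx]; rewrite -[x]mul1r.
by apply: ideal_generated_scale; [exact: local_ring1 | exists f; rewrite ?fs_gs].
Qed.

(** In the local ring the form [h] is a unit, so [f] lies in the ideal of the
    [g i]: a local equation [f / g0] of the new curve is the combination of the
    local equations [g i / h] with coefficients [a i / g0].  The equality is
    one of predicates, so that it carries over to powers of the ideal. *)
Lemma local_ideal_rcons p (I : eqType) (s : seq I) (a g : I -> {mpoly C[3]})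
    h f d e :
    {in s, forall i, a i \is e.-homog} -> {in s, forall i, g i \is d.-homog} ->
    h \is d.-homog -> f \is e.-homog -> h.@[p 0] != 0 ->
    h * f = \sum_(i <- s) a i * g i ->
  local_ideal p (rcons [seq g i | i <- s] f) = local_ideal p [seq g i | i <- s].
Proof.
move=> a_e g_d h_d f_e hp0 hfE; apply/funext => x; apply/propext; split; last first.
  by apply: local_ideal_subset => y y_fs; rewrite mem_rcons inE y_fs orbT.
apply: ideal_generated_subset; first exact: local_ringM.
move=> {}x [f0]; rewrite mem_rcons inE => /predU1P[->|f0_fs] f0x; last first.
  rewrite -[x]mul1r; apply: ideal_generated_scale; first exact: local_ring1.
  by exists f0.
have [e' [g0 [f_e' g0_e' g0p ->]]] := f0x.
(* The zero form is homogeneous of every degree, so the degree of [g0] is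
   known only when [f] is nonzero. *)
have [->|f_neq0] := eqVneq f 0; first by rewrite rmorph0 mul0r; apply: ideal_generated0.
have e'E := dhomog_uniq f_neq0 f_e' f_e; rewrite {e'}e'E in f_e' g0_e'.
have h_neq0 : h != 0 by apply: contraNneq hp0 => ->; rewrite rmorph0.
have g0_neq0 : g0 != 0 by apply: contraNneq g0p => ->; rewrite rmorph0.
have -> : tofrac f / tofrac g0
    = \sum_(i <- s) (tofrac (a i) / tofrac g0) * (tofrac (g i) / tofrac h).
  under eq_bigr do rewrite mulf_div -!tofracM.
  rewrite -mulr_suml -rmorph_sum -hfE [h * f]mulrC /= !tofracM -mulf_div.
  by rewrite divff ?mulr1 ?tofrac_eq0.
apply: ideal_generated_sum => i i_s; apply: ideal_generated_scale.
  by exists e, (a i), g0; rewrite a_e.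
exists (g i); first by apply: map_f.
by exists d, h; rewrite g_d.
Qed.

(** The points and multiplicities of an intersection depend on the system only
    through its common zeros and its local ideals at them. *)
Lemma intersection_points_rcons fs f N :
    (forall p, common_zero fs p ->
       f.@[p 0] = 0 /\ local_ideal p (rcons fs f) = local_ideal p fs) ->
  intersection_points fs N -> intersection_points (rcons fs f) N.
Proof.
move=> fP.
have zeroE p : common_zero (rcons fs f) p <-> common_zero fs p.
  split=> [[p0 fsp]|fsp]; first split=> // g g_fs.
    by apply: fsp; rewrite mem_rcons inE g_fs orbT.
  split; first by case: fsp.
  move=> g; rewrite mem_rcons inE => /predU1P[->|]; first by case: (fP p fsp).
  by case: fsp => _; apply.
move=> [k [pt [e [ptP pt_inj pt_surj eP eN]]]]; exists k, pt, e.
split=> // [i|q /zeroE|i]; [by apply/zeroE | exact: pt_surj |].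
by rewrite /intersection_multiplicity (fP _ (ptP i)).2; apply: eP.
Qed.

End LocalIdeal.

(** * Homogenization *)

Section Homogenization.
Variable R : realType.
Implicit Types (p q : {mpoly R[2]}).

Let hmon n (m : 'X_{1..2}) : 'X_{1..3} :=
  [multinom [tuple m 0; m 1; (n - mdeg m)%N]].

(** A range of monomials that does not depend on [p] is what makes linearity
    visible. *)
Lemma homogenizewE n k p : (msize p <= k)%N ->
  homogenize n p = \sum_(m : 'X_{1..2 < k}) p@_m *: 'X_[hmon n m].
Proof.
move=> le_pk; rewrite /homogenize (big_mksub 'X_{1..2 < k}) ?msupp_uniq //=.
  by rewrite big_rmcond //= => m /memN_msupp_eq0->; rewrite scale0r.
by move=> m /msize_mdeg_lt /leq_trans; apply.
Qed.

Lemma homogenize_is_linear n : linear (@homogenize R n).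
Proof.
move=> c p q; pose k := maxn (msize (c *: p + q)) (maxn (msize p) (msize q)).
rewrite !(@homogenizewE n k) ?leq_max ?leqnn ?orbT //.
rewrite scaler_sumr -big_split; apply: eq_bigr => m _.
by rewrite mcoeffD mcoeffZ scalerDl scalerA.
Qed.

HB.instance Definition _ n :=
  GRing.isLinear.Build R {mpoly R[2]} {mpoly R[3]} _ (@homogenize R n)
    (homogenize_is_linear n).

Lemma homogenizeX n m : homogenize n 'X_[R, m] = 'X_[hmon n m].
Proof. by rewrite /homogenize msuppX big_seq1 mcoeffX eqxx scale1r. Qed.

Lemma hmonD n k m1 m2 : (mdeg m1 <= n)%N -> (mdeg m2 <= k)%N ->
  hmon (n + k) (m1 + m2) = (hmon n m1 + hmon k m2)%MM.
Proof.
move=> le_m1 le_m2; apply/mnmP => i; rewrite /hmon mdegD !mnmDE !multinomE.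
rewrite !(tnth_nth 0%N); case: i => [[|[|[|i]]]] //= _.
by rewrite addnBA // addnBAC // subnDA.
Qed.

(** By bilinearity it is enough to compare monomials; the degree bounds keep the
    truncated exponents of the third variable additive ([hmonD]). *)
Lemma homogenizeM n k p q : (msize p <= n.+1)%N -> (msize q <= k.+1)%N ->
  homogenize (n + k) (p * q) = homogenize n p * homogenize k q.
Proof.
move=> sp sq; rewrite mpolyME linear_sum big_allpairs /= [RHS]big_distrlr /=.
apply: eq_big_seq => m1 /msize_mdeg_lt m1p.
apply: eq_big_seq => m2 /msize_mdeg_lt m2q.
rewrite linearZ /= homogenizeX hmonD; last 2 first.
- by rewrite -ltnS (leq_trans m1p).
- by rewrite -ltnS (leq_trans m2q).
by rewrite mpolyXD -scalerAl -scalerAr scalerA.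
Qed.

Lemma homogenize_dhomog n p : (msize p <= n.+1)%N -> homogenize n p \is n.-homog.
Proof.
move=> sp; rewrite /homogenize big_seq; apply: rpred_sum => m /msize_mdeg_lt mp.
apply: dhomogZ; rewrite dhomogX /= mdegE !big_ord_recr big_ord0 /= add0n.
rewrite !multinomE !(tnth_nth 0%N) /=; apply/eqP.
have -> : (m 0%R + m 1%R = mdeg m)%N.
  rewrite mdegE !big_ord_recr big_ord0 /= add0n.
  by congr (m _ + m _)%N; apply: val_inj.
by rewrite subnKC // -ltnS (leq_trans mp).
Qed.

Lemma complex_form_dhomog n p :
  (msize p <= n.+1)%N -> complex_form n p \is n.-homog.
Proof.
move=> sp; apply/dhomogP => m.
rewrite mcoeff_msupp mcoeff_map_mpoly => m_neq0.
apply: (dhomogP _ _ _ (homogenize_dhomog sp)); rewrite mcoeff_msupp.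
by apply: contraNneq m_neq0 => ->.
Qed.

Lemma complex_form_follows n m (P L : 'I_4 -> {mpoly R[2]}) :
    (forall i, (msize (P i) <= n.+1)%N) -> (forall i, (msize (L i) <= m.+1)%N) ->
    follows L P ->
  \sum_(i < 4) complex_form m (L i) * complex_form n (P i) = 0.
Proof.
move=> degP degL LP0.
transitivity (complex_form (m + n) (\sum_(i < 4) L i * P i)); last first.
  by rewrite LP0 /complex_form linear0 rmorph0.
rewrite /complex_form linear_sum rmorph_sum; apply: eq_bigr => i _.
by rewrite /= homogenizeM // rmorphM.
Qed.

End Homogenization.

(** * Moving planes *)

Lemma sum_ord4 (V : nmodType) (F : 'I_4 -> V) :
  \sum_(i < 4) F i = \sum_(i <- [:: 0; 1; 2]) F i + F 3.
Proof.
rewrite !big_ord_recr big_ord0 /= !big_cons big_nil add0r addr0 addrA.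
by congr (F _ + F _ + F _ + F _); apply: val_inj.
Qed.

(** Replacing [w * P i] by [(w * P i - X i * d) + X i * d] in
    [w * \sum_i L i * P i = 0]; the term of index 3 drops out of the first
    part. *)
Lemma moving_plane_identity (F : comNzRingType) (A : comAlgType F)
    (P L : 'I_4 -> A) (X : 'I_4 -> F) :
    \sum_(i < 4) L i * P i = 0 ->
  P 3 * (\sum_(i < 4) X i *: L i) =
    \sum_(i <- [:: 0; 1; 2]) - L i * (X 3 *: P i - X i *: P 3).
Proof.
move=> LP0; pose T i := - L i * (X 3 *: P i - X i *: P 3).
have T3 : T 3 = 0 by rewrite /T subrr mulr0.
rewrite -[RHS]addr0 -[X in _ + X]T3 -(sum_ord4 T) mulr_sumr.
apply/eqP; rewrite -subr_eq0 -sumrB.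
rewrite (eq_bigr (fun i => X 3 *: (L i * P i))) => [|i _].
  by rewrite -scaler_sumr LP0 scaler0.
by rewrite /T mulNr opprK mulrBr -!scalerAr mulrC addrC subrK.
Qed.

Lemma meval_eq0_of_point_eqn (C : fieldType) k (f d : {mpoly C[k]}) (w x : C)
    (v : 'I_k -> C) :
  w != 0 -> d.@[v] = 0 -> (w *: f - x *: d).@[v] = 0 -> f.@[v] = 0.
Proof.
move=> w_neq0 dv0 /eqP; rewrite mevalB !mevalZ dv0 mulr0 subr0.
by rewrite mulf_eq0 (negPf w_neq0) => /eqP.
Qed.

Theorem theorem6 (R : realType) (n m r : nat)
    (P L : 'I_4 -> {mpoly R[2]}) (X0 : 'rV[R[i]]_4)
    (surfP : rational_surface P)
    (degP : forall i, (msize (P i) <= n.+1)%N)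
    (nbpP : no_base_points n P)
    (degL : forall i, (msize (L i) <= m.+1)%N)
    (followsLP : follows L P)
    (w0_neq0 : X0 0 3 != 0)
    (X0_on : on_surface P X0)
    (X0_fold : fold_singular_point r n P X0) :
  intersection_points (rcons (point_system n P X0) (moving_plane_at m L X0)) r.
Proof.
have [_ Xr] := X0_fold; apply: intersection_points_rcons Xr => p [p_neq0 fsp].
pose d := complex_form n (P 3).
pose eqn i := X0 0 3 *: complex_form n (P i) - X0 0 i *: d.
have eqn0 : {in [:: 0; 1; 2], forall i, (eqn i).@[p 0] = 0}.
  by move=> i i012; apply: fsp; apply: (map_f eqn).
have dp_neq0 : d.@[p 0] != 0.
  apply/eqP => dp0; apply: nbpP; exists p; split=> [|i]; first exact: p_neq0.
  have [i012|] := boolP (i \in [:: 0; 1; 2]).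
    exact: meval_eq0_of_point_eqn w0_neq0 dp0 (eqn0 i i012).
  rewrite -[RHS]dp0 /d => i3; congr (complex_form n (P _)).@[p 0].
  by apply: val_inj; case: i i3 => [[|[|[|[|i]]]]].
have key := moving_plane_identity (X0 0) (complex_form_follows degP degL followsLP).
have plane_homog : moving_plane_at m L X0 \is m.-homog.
  by apply: rpred_sum => i _; apply/dhomogZ/complex_form_dhomog.
split.
  apply: (mulfI dp_neq0); rewrite mulr0 -mevalM key raddf_sum big_seq big1 //.
  by move=> i i012; rewrite /= mevalM (eqn0 i i012) mulr0.
apply: (local_ideal_rcons _ _ _ plane_homog dp_neq0 key) => [i _|i _|].
- by rewrite rpredN complex_form_dhomog.
- by apply: rpredB; apply/dhomogZ/complex_form_dhomog.
- exact: complex_form_dhomog.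
Qed.
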